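(* Let $X$ be a functionally Hausdorff space with $\alpha(X)<\mathfrak c$. Then the following conditions are equivalent: (1) $X$ is $k$-scattered; (2) for any continuous map $f:X\to Y$ to a functionally Hausdorff space $Y$, the image $f(X)$ has cardinality not exceeding $\max\{\alpha(X),\psi(Y)\}$; (3) for any continuous map $f:X\to Y$ to a metrizable space $Y$, the image $f(X)$ has cardinality strictly less than $\mathfrak c$; (4) no continuous map $f:X\to[0,1]$ is surjective.
   Context: $\mathfrak c$ denotes the cardinality of the continuum. A topological space is scattered if every non-empty subspace of it contains an isolated point (of that subspace). A topological space $X$ is $k$-scattered if every compact subspace of $X$ is scattered. A topological space $X$ is functionally Hausdorff if for any distinct points $x,y\in X$ there exists a continuous map $f:X\to[0,1]$ with $f(x)=0$ and $f(y)=1$. A space is Čech-complete if it is Tychonoff and is a $G_\delta$-set in some (equivalently, any) of its compactifications. The Lindelöf number $l(X)$ of a topological space $X$ is the smallest infinite cardinal $\kappa$ such that any open cover of $X$ has a subcover of cardinality not exceeding $\kappa$. The pseudocharacter $\psi(X)$ of a topological space $X$ is the smallest cardinal $\kappa$ such that for any point $x\in X$ the family $\tau_x$ of all open neighborhoods of $x$ contains a subfamily $\mathcal U_x\subset\tau_x$ of cardinality $|\mathcal U_x|\le\kappa$ with $\bigcap\mathcal U_x=\bigcap\tau_x$. For a cardinal $\kappa$, a topological space $X$ is $\kappa$-analytic if $X$ is a continuous image of a Čech-complete space $P$ with $l(P)\le\kappa$. The analyticity $\alpha(X)$ of a topological space $X$ is the smallest cardinal $\kappa$ for which $X$ is $\kappa$-analytic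 (it is well-defined since every space is a continuous image of a discrete space). *)

(* Defs.v *)
From HB Require Import structures.
From mathcomp Require Import all_boot all_order all_algebra.
From mathcomp Require Import all_classical all_reals all_analysis.
From mathcomp Require Import borel_hierarchy.

Set Implicit Arguments.
Unset Strict Implicit.
Unset Printing Implicit Defensive.

Import Order.TTheory GRing.Theory Num.Theory.
Import numFieldNormedType.Exports.

Local Open Scope classical_set_scope.
Local Open Scope card_scope.

(** Cardinals are represented by types, and compared by [#<=] (existence of an
    injection) between the corresponding full sets. *)

Definition card_lt T U (A : set T) (B : set U) : bool :=
  (A #<= B) && ~~ (B #<= A).

Notation "A '#<' B" := (card_lt A B)
  (at level 79, format "A  '#<'  B") : card_scope.

Definition card_max (K L : Type) : Type :=
  if [set: K] #<= [set: L] then L else K.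

Lemma card_least (I U : Type) (F : I -> set U) (i0 : I) :
  exists i, forall j, F i #<= F j.
Proof.
pose P (S : set (I -> U)) :=
  (forall g, S g -> forall i, F i (g i)) /\
  (forall g h, S g -> S h -> forall i, g i = h i -> g = h).
have [] := @Zorn_bigcup (I -> U) P.
  move=> C CP Ctot; split.
    by move=> g [S CS Sg]; exact: (CP _ CS).1.
  move=> g h [S CS Sg] [S' CS' S'h] i ghi.
  have [SS'|S'S] := Ctot _ _ CS CS'.
    by apply: (CP _ CS').2 ghi => //; exact: SS'.
  by apply: (CP _ CS).2 ghi => //; exact: S'S.
move=> S [[SF Sinj] Smax].
have [i Fi] : exists i, F i `<=` [set g i | g in S].
  apply: contrapT => /forallNP nF.
  have /choice [g gP] : forall i, exists u, F i u /\ ~ [set h i | h in S] u.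
    by move=> i; have /existsNP [u /not_implyP uP] := nF i; exists u.
  apply: (Smax (S `|` [set g])).
    split; first exact: subsetUl.
    by move=> /(_ g (or_intror erefl)) Sg; apply: (gP i0).2; exists g.
  split.
    by move=> h [/SF //|-> i]; exact: (gP i).1.
  move=> h k [Sh|->] [Sk|->] i //.
  - exact: Sinj.
  - by move=> hk; exfalso; apply: (gP i).2; exists h.
  - by move=> hk; exfalso; apply: (gP i).2; exists k.
exists i => j.
apply: card_le_trans (subset_card_le Fi) _.
apply: card_le_trans (card_image_le _ _) _.
have Sj : {in S &, injective (fun g => g j)}.
  by move=> g h /set_mem Sg /set_mem Sh; exact: Sinj.
have /card_eqPle [_ SjS] := inj_card_eq Sj.
apply: card_le_trans SjS (subset_card_le _).
by move=> _ [g Sg <-]; exact: SF.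
Qed.

Lemma card_le_total T U (A : set T) (B : set U) : (A #<= B) || (B #<= A).
Proof.
pose F (b : bool) : set (T + U) := if b then inl @` A else inr @` B.
have FA : [set (inl x : T + U) | x in A] #= A.
  by apply: inj_card_eq => x y _ _ [].
have FB : [set (inr x : T + U) | x in B] #= B.
  by apply: inj_card_eq => x y _ _ [].
have [[] /= le] := card_least F true.
  by apply/orP; left; have := le false; rewrite (card_le_eql FA) (card_le_eqr FB).
by apply/orP; right; have := le true; rewrite (card_le_eql FB) (card_le_eqr FA).
Qed.

Lemma card_wf (P : Type -> Prop) : (exists K, P K) ->
  exists K, P K /\ forall L, P L -> [set: K] #<= [set: L].
Proof.
move=> [K0 PK0].
pose I := {A : set K0 | exists K, P K /\ [set: K] #= A}.
pose F (i : I) : set K0 := projT1 i.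
have i0 : I by exists setT, K0; split => //; exact: card_eqxx.
have [[A [K [PK KA]]] Ale] := card_least F i0.
exists K; split => // L PL; rewrite (card_le_eql KA).
have {i0}[/card_subP [B LB _]|K0L] := orP (card_le_total [set: L] [set: K0]).
  have BI : exists K, P K /\ [set: K] #= B.
    by exists L; split => //; rewrite card_eq_sym.
  by rewrite -(card_le_eqr LB); exact: Ale (exist _ B BI).
by apply: card_le_trans K0L; apply: subset_card_le.
Qed.

(** The least cardinal satisfying [P], as a type defined up to bijection;
    [P] is meant to be invariant under bijections. *)
Definition min_card (P : Type -> Prop) (exP : exists K, P K) : Type :=
  projT1 (cid (card_wf exP)).

Lemma min_cardP (P : Type -> Prop) (exP : exists K, P K) :
  P (min_card exP) /\ forall L, P L -> [set: min_card exP] #<= [set: L].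
Proof. by rewrite /min_card; case: cid. Qed.

Definition scattered (X : topologicalType) : Prop :=
  forall A : set X, A !=set0 -> isolated A !=set0.

(** [set_type K] carries the subspace topology. *)
Definition k_scattered (X : topologicalType) : Prop :=
  forall K : set X, compact K -> scattered (set_type K).

Definition functionally_hausdorff (R : realType) (X : topologicalType) : Prop :=
  forall x y : X, x <> y -> exists f : X -> R,
    [/\ continuous f, range f `<=` `[0%R, 1%R], f x = 0%R & f y = 1%R].

Definition tychonoff_space (X : topologicalType) : Prop :=
  accessible_space X /\ completely_regular_space X.

(** [wopen e] is the family of preimages under [e] of the open sets of [Y]. *)
Definition embedding (X Y : topologicalType) (e : X -> Y) : Prop :=
  injective e /\ @open X = wopen e.

(** [(C, e)] is a Hausdorff compactification of [X]. *)
Definition compactification (X C : topologicalType) (e : X -> C) : Prop :=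
  [/\ compact [set: C], hausdorff_space C, embedding e & dense (range e)].

Definition cech_complete (X : topologicalType) : Prop :=
  tychonoff_space X /\
  exists (C : topologicalType) (e : X -> C),
    compactification e /\ Gdelta (range e).

(** [l(X) <= K]. *)
Definition lindelof_bound (X : topologicalType) (K : Type) : Prop :=
  infinite_set [set: K] /\
  forall C : set (set X), C `<=` open -> \bigcup_(U in C) U = setT ->
  exists D : set (set X),
    [/\ D `<=` C, \bigcup_(U in D) U = setT & D #<= [set: K]].

Lemma lindelof_bound_ex (X : topologicalType) : exists K, lindelof_bound X K.
Proof.
exists (nat + set X)%type; split.
  have E : [set (inl n : nat + set X) | n in [set: nat]] #= [set: nat].
    by apply: inj_card_eq => m n _ _ [].
  by apply/infiniteP; rewrite -(card_le_eql E); exact: subset_card_le.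
move=> C _ Ccov; exists C; split => //.
have E : [set (inr U : nat + set X) | U in C] #= C.
  by apply: inj_card_eq => U V _ _ [].
by rewrite -(card_le_eql E); exact: subset_card_le.
Qed.

Definition lindelof_number (X : topologicalType) : Type :=
  min_card (lindelof_bound_ex X).

(** [psi(X) <= K]. *)
Definition pseudocharacter_bound (X : topologicalType) (K : Type) : Prop :=
  forall x : X, exists V : set (set X),
    [/\ V `<=` open_nbhs x, V #<= [set: K] &
        \bigcap_(U in V) U = \bigcap_(U in open_nbhs x) U].

Lemma pseudocharacter_bound_ex (X : topologicalType) :
  exists K, pseudocharacter_bound X K.
Proof.
exists (set X) => x; exists (open_nbhs x); split => //.
exact: subset_card_le.
Qed.

Definition pseudocharacter (X : topologicalType) : Type :=
  min_card (pseudocharacter_bound_ex X).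

Definition analytic (K : Type) (X : topologicalType) : Prop :=
  exists (P : topologicalType) (f : P -> X),
    [/\ cech_complete P, [set: lindelof_number P] #<= [set: K],
        continuous f & range f = setT].

Lemma discrete_cech_complete (T : choiceType) :
  cech_complete (discrete_topology T).
Proof.
pose X : discreteUniformType := discrete_topology T.
have hX : hausdorff_space X by exact: discrete_hausdorff.
have lcX : locally_compact [set: X].
  move=> x _; rewrite withinET; exists [set x].
    exact: discrete_set1.
  by split; [exact: compact_set1|exact: discrete_closed].
split.
  split; first exact: hausdorff_accessible.
  move=> a B _ nBa.
  exists (Uniform.class X), (range (fun x => (x, x))); split => //=.
  by rewrite -subset0 => -[x y] /= [[xa By] [z _ [zx zy]]]; apply: nBa; rewrite -xa -zx zy.
  by move=> x; exact: subset_refl.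
have [cX|ncX] := pselect (compact [set: X]).
  exists X, idfun; split; first split => //.
  - split => //; apply/seteqP; split => A; first by move=> _; exists A => //; exact: discrete_open.
    by move=> _; exact: discrete_open.
  - move=> O [x Ox] _; exists x; split => //; by exists x.
  - apply: open_Gdelta; exact: discrete_open.
have oSome (A : set X) : @open (one_point_compactification X) (Some @` A).
  by apply: one_point_compactification_open_some; exact: discrete_open.
exists (one_point_compactification X), Some; split; last first.
  exact/open_Gdelta/oSome.
split.
- exact: one_point_compactification_compact.
- exact: one_point_compactification_hausdorff.
- split; first by move=> x y [].
  apply/seteqP; split => A _; last exact: discrete_open.
  exists (Some @` A); first exact: oSome.
  by apply/seteqP; split => x; [move=> [y Ay [<-]]|exists x].
- move=> O [[x|] Ox] oO; first by exists (Some x); split => //; exists x.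
  have [W [cW _] WO] : nbhs (None : one_point_compactification X) O.
    exact: open_nbhs_nbhs.
  have [x nWx] : exists x, ~ W x.
    apply/existsNP => WT; apply: ncX; suff <- : W = setT by [].
    by apply/seteqP; split.
  by exists (Some x); split; [apply: WO; left; exists x|exists x].
Qed.

Lemma analytic_ex (X : topologicalType) : exists K, analytic K X.
Proof.
exists (lindelof_number (discrete_topology X)).
exists (discrete_topology X), idfun; split.
- exact: discrete_cech_complete.
- exact: card_lexx.
- by move=> x A /nbhs_singleton Ax; rewrite nbhs_simpl /=; exact/principal_filterP.
- by apply/seteqP; split => // x _; exists x.
Qed.

Definition analyticity (X : topologicalType) : Type :=
  min_card (analytic_ex X).

(* Main.v *)
Require Import Defs.
From mathcomp Require Import all_boot all_order all_algebra.
From mathcomp Require Import all_classical all_reals all_analysis.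
From mathcomp Require Import ring lra.
Import Order.TTheory GRing.Theory Num.Theory.
Import numFieldNormedType.Exports.
Local Open Scope classical_set_scope.
Local Open Scope card_scope.

Set Implicit Arguments.
Unset Strict Implicit.
Unset Printing Implicit Defensive.

(** Write [kappa] for the maximum of the analyticity of [X] and the
    pseudocharacter of [Y], and present [X] as the image [p P] of a
    Cech-complete space [P] with Lindelof number at most [kappa].

    The engine is a Cantor scheme ([compact_onto_interval]). Let [g : P -> Y] be
    continuous and let [T] be a non-empty subset of [P] such that [g] is not
    constant on [T `&` U] for any open [U] meeting [T]. Choose inductively, for
    each word [s] of length [n], an open set [U_s] of a compactification of [P]
    that meets [T], has its closure inside both its parent and the [n]-th open
    set of a sequence whose intersection is [P], together with functions
    [h_n : Y -> [0,1]] that take the value [b] on the [g]-image of every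
    [U_(b :: s)] with [s] of length [n]. One function per level rather than one
    per node is possible because a functionally Hausdorff space has functions
    separating any two disjoint finite sets. The points lying in some
    [closure U_s] for every length of [s] form a compact subset of [P], on which
    the sequence [(h_n o g)] attains every 0-1 sequence; hence
    [phi = sum_n h_n / 2^(n+1)] is a continuous map from [Y] to [0,1] that sends
    the [g]-image of this compact set onto [0,1]. The scheme thereby yields
    functions defined on all of [Y], and no extension theorem is called for.

    (1) -> (2). If [f X] has more than [kappa] points, let [T] be the set of
    points of [P] all of whose neighbourhoods have images of cardinality larger
    than [kappa] under [g = f o p]. A closed set missing [T] has a small image,
    by the Lindelof property, and a point of [Y] is the intersection of at most
    [kappa] open sets; so [T] is non-empty and [g] is not constant on any trace
    [T `&` U] ([condensation_split]). The scheme gives a compact subset of [X]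
    that is mapped onto [0,1], and such a set is not scattered: a minimal closed
    subset that is still mapped onto [0,1] has no isolated point
    ([compact_scattered_not_onto]). These counts rest on [kappa * kappa = kappa]
    for infinite [kappa] ([infinite_square]).

    (2) -> (3). Metric spaces have countable pseudocharacter.

    (3) -> (4). The interval [0,1] is metrizable of cardinality continuum.

    (4) -> (1). If some compact [Z] in [X] contains a non-empty [A] without
    isolated points, the scheme applies to [P = Z], [T = A] and to the inclusion
    of [Z] in [X], and [phi] is a surjection of [X] onto [0,1]. *)

(** * Cardinal arithmetic *)

(** Working with a total injective relation rather than with an injective
    function spares the inhabitant of [U] needed to define a function outside
    [A], and any choice of images. *)
Lemma card_le_relP T U (A : set T) (B : set U) :
  A #<= B <-> exists r : T -> U -> Prop,
    (forall x, A x -> exists2 y, B y & r x y) /\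
    (forall x x' y, A x -> A x' -> r x y -> r x' y -> x = x').
Proof.
split=> [/card_leP[f]|[r [r_tot r_inj]]].
  exists (fun x y => exists2 a : A, val a = x & val (f a) = y); split.
    move=> x Ax; exists (val (f (SigSub (mem_set Ax)))).
      exact/set_mem/valP.
    by exists (SigSub (mem_set Ax)).
  move=> x x' y _ _ [a <- fay] [a' <- fa'y].
  have /val_inj faa' : val (f a) = val (f a') by rewrite fay fa'y.
  by congr (val _); apply: (@inj _ _ _ f) => //; exact: in_setT.
have /choice[g gP] : forall a : A, exists b : B, r (val a) (val b).
  move=> a; have [y By ry] := r_tot _ (set_mem (valP a)).
  by exists (SigSub (mem_set By)).
have g_inj : {in [set: A] &, injective g}.
  move=> a a' _ _ gaa'; apply/val_inj/(r_inj _ _ _ _ _ (gP a)).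
  - exact/set_mem/valP.
  - exact/set_mem/valP.
  - by rewrite gaa'; exact: gP.
rewrite -(card_le_eql (card_setT A)) -(card_le_eqr (card_setT B)).
rewrite -(card_le_eql (inj_card_eq g_inj)).
exact: subset_card_le.
Qed.

Lemma card_leX T T' U U' (A : set T) (B : set U) (A' : set T') (B' : set U') :
  A #<= A' -> B #<= B' -> A `*` B #<= A' `*` B'.
Proof.
move=> /card_le_relP[r [rt ri]] /card_le_relP[s [st si]].
apply/card_le_relP; exists (fun p q => r p.1 q.1 /\ s p.2 q.2); split.
  move=> [x y] [/= /rt[x' A'x' rx] /st[y' B'y' sy]].
  by exists (x', y').
move=> [x y] [x' y'] [u v] /= [Ax By] [Ax' By'] [rx sy] [rx' sy'].
by congr pair; [exact: ri rx rx'|exact: si sy sy'].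
Qed.

(** The two halves are tagged with two distinct points of [C]. *)
Lemma card_leU T U (A B : set T) (C : set U) :
  infinite_set C -> C `*` C #<= C -> A #<= C -> B #<= C -> A `|` B #<= C.
Proof.
move=> /infiniteP/card_le_relP[n [nt ni]] CC.
move=> /card_le_relP[r [rt ri]] /card_le_relP[s [st si]].
apply: card_le_trans CC.
have [c0 Cc0 n0] := nt 0%N I; have [c1 Cc1 n1] := nt 1%N I.
have c01 : c0 <> c1 by move=> E; move: n1; rewrite -E => /(ni _ _ _ I I n0).
apply/card_le_relP; exists (fun x p => (A x /\ r x p.1 /\ p.2 = c0) \/
  (~ A x /\ s x p.1 /\ p.2 = c1)); split.
  move=> x [|Bx]; have [Ax|nAx] := pselect (A x) => //.
  - by have [y Cy rxy] := rt _ Ax; exists (y, c0) => //; left.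
  - by have [y Cy rxy] := rt _ Ax; exists (y, c0) => //; left.
  - by have [y Cy rxy] := st _ Bx; exists (y, c1) => //; right.
move=> x x' [y c] /= ABx ABx' [[Ax [rx cE]]|[nAx [sx cE]]]
  [[Ax' [rx' cE']]|[nAx' [sx' cE']]].
- exact: ri rx rx'.
- by case: c01; rewrite -cE cE'.
- by case: c01; rewrite -cE' cE.
- by apply: si sx sx'; [case: ABx|case: ABx'].
Qed.

Section square.
Variable T : Type.

Let fld (G : set (T * T * T)) : set T := [set x | exists z, G (x, x, z)].

(** A partial injection of [B * B] into [B], with [B = fld G], given by its graph;
    only injectivity is demanded, so that graphs can be enlarged by mere
    unions. *)
Record square_rel (G : set (T * T * T)) : Prop := SquareRel {
  square_tot : forall x y, fld G x -> fld G y -> exists z, G (x, y, z);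
  square_dom : forall x y z, G (x, y, z) -> [/\ fld G x, fld G y & fld G z];
  square_inj : forall x y x' y' z, G (x, y, z) -> G (x', y', z) ->
    x = x' /\ y = y' }.

Lemma square_card G : square_rel G -> fld G `*` fld G #<= fld G.
Proof.
move=> GP; apply/card_le_relP; exists (fun p z => G (p.1, p.2, z)); split.
  move=> [x y] [/= Gx Gy]; have [z Gz] := square_tot GP Gx Gy.
  by exists z => //; have [] := square_dom GP Gz.
by move=> [x y] [x' y'] z _ _ /= G1 G2; have [-> ->] := square_inj GP G1 G2.
Qed.

Lemma square_bigcup (F : set (set (T * T * T))) :
  F !=set0 -> F `<=` square_rel -> total_on F subset ->
  square_rel (\bigcup_(G in F) G).
Proof.
move=> [G0 FG0] FP Ftot.
have fldU G x : F G -> fld G x -> fld (\bigcup_(G in F) G) x.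
  by move=> FG [z Gz]; exists z; exists G.
have join G H : F G -> F H -> exists2 J, F J & G `<=` J /\ H `<=` J.
  by move=> FG FH; have [GH|HG] := Ftot _ _ FG FH; [exists H|exists G] => //; split.
split.
- move=> x y [z [G FG Gz]] [z' [H FH Hz]].
  have [J FJ [GJ HJ]] := join _ _ FG FH.
  have [||w Jw] := @square_tot J (FP _ FJ) x y.
  + by exists z; exact: GJ.
  + by exists z'; exact: HJ.
  + by exists w; exists J.
- move=> x y z [G FG Gxyz]; have [? ? ?] := square_dom (FP _ FG) Gxyz.
  by split; apply: (fldU G).
- move=> x y x' y' z [G FG Gz] [H FH Hz].
  have [J FJ [GJ HJ]] := join _ _ FG FH.
  by apply: (square_inj (FP _ FJ) (GJ _ Gz)); exact: HJ.
Qed.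

(** If the complement of the field [B] is not dominated by [B], it contains a
    copy [C] of [B]; since [(B `|` C)] is equinumerous with [B], the new pairs of
    [(B `|` C) `*` (B `|` C)] can all be sent into [C]. *)
Lemma square_extend G : square_rel G -> infinite_set (fld G) ->
  ~ (~` fld G #<= fld G) -> exists2 H, square_rel H & G `<` H.
Proof.
move=> GP Ginf /negP nle; set B := fld G in Ginf nle *.
have BB : B `*` B #<= B by exact: square_card.
have /card_subP[C CB CnB] : B #<= ~` B.
  by have /orP[|] := card_le_total B (~` B) => // /(negP nle).
pose E := B `|` C.
have EC : E `*` E #<= C.
  have EB : E #<= B by apply: card_leU => //; rewrite (card_le_eql CB).
  by rewrite (card_le_eqr CB); apply: card_le_trans BB; exact: card_leX.
have [j [jt ji]] := (card_le_relP _ _).1 EC.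
pose H := G `|` [set p | [/\ E p.1.1, E p.1.2, ~ (B p.1.1 /\ B p.1.2),
  C p.2 & j p.1 p.2]].
have GE x y z : G (x, y, z) -> [/\ B x, B y & B z] by exact: square_dom.
have fldE : fld H = E.
  apply/seteqP; split => x.
    move=> [z [Gx|[/= Ex _ _ _ _]]]; last exact: Ex.
    by left; have [] := GE _ _ _ Gx.
  case=> [[z Gxz]|Cx]; first by exists z; left.
  have Ex : E x by right.
  have [z Cz jz] := jt (x, x) (conj Ex Ex).
  exists z; right; split => //= -[Bx _]; exact: CnB Bx.
exists H.
  split; rewrite ?fldE.
  - move=> x y Ex Ey; have [[Bx By]|nB] := pselect (B x /\ B y).
      by have [z Gz] := square_tot GP Bx By; exists z; left.
    by have [z Cz jz] := jt (x, y) (conj Ex Ey); exists z; right.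
  - move=> x y z [/GE[Bx By Bz]|[/= Ex Ey _ Cz _]]; first by split; left.
    by split => //; right.
  - move=> x y x' y' z [Gz|[/= Ex Ey nB Cz jz]] [Gz'|[/= Ex' Ey' nB' Cz' jz']].
    + exact: square_inj Gz Gz'.
    + by have [_ _ Bz] := GE _ _ _ Gz; have := CnB _ Cz' Bz.
    + by have [_ _ Bz] := GE _ _ _ Gz'; have := CnB _ Cz Bz.
    + by have [-> ->] := ji (x, y) (x', y') z (conj Ex Ey) (conj Ex' Ey') jz jz'.
split; first exact: subsetUl.
have [c Cc] : C !=set0.
  apply/set0P; rewrite -(@card_eq0 _ T) (card_eql CB) card_eq0.
  exact/set0P/infinite_setN0.
move=> HG; apply: (CnB c Cc).
have Ec : E c by right.
rewrite -fldE in Ec; case: Ec => z /HG Gz; by exists z.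
Qed.

(** By Zorn, take a maximal square relation containing a fixed one with countably
    infinite field. Its field is infinite, and since it cannot be extended it
    dominates its complement, hence the whole type. *)
Lemma infinite_square : infinite_set [set: T] ->
  [set: T] `*` [set: T] #<= [set: T].
Proof.
move=> /infiniteP/card_le_relP[n [nt ni]].
have /choice[g gP] : forall i, exists x, n i x.
  by move=> i; have [x _ nx] := nt i I; exists x.
have g_inj i j : g i = g j -> i = j.
  by move=> gij; apply: (ni _ _ (g i)) => //; rewrite gij.
have /card_eqPle[/card_le_relP[m [mt mi]] _] := card_nat2.
have /choice[p pP] : forall i, exists j, m i j.
  by move=> i; have [x _ nx] := mt i I; exists x.
have p_inj i j : p i = p j -> i = j.
  by move=> gij; apply: (mi _ _ (p i)) => //; rewrite gij.
pose G0 : set (T * T * T) := [set (g a.1, g a.2, g (p a)) | a in [set: nat * nat]].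
have fld0 i : fld G0 (g i) by exists (g (p (i, i))), (i, i).
have G0P : square_rel G0.
  split.
  - move=> _ _ [z [[a1 a2] _ [<- _ _]]] [z' [[b1 b2] _ [<- _ _]]] /=.
    by exists (g (p (a1, b1))), (a1, b1).
  - by move=> _ _ _ [a _ [<- <- <-]].
  - move=> _ _ _ _ _ [[a1 a2] _ [<- <- <-]] [[b1 b2] _ [<- <-]] /=.
    by move=> /g_inj/p_inj[-> ->].
(* Adjoining [G0] makes the empty chain harmless and every field infinite. *)
have [] := @Zorn_bigcup _ (fun G => square_rel (G0 `|` G)).
  move=> F FP Ftot.
  have -> : G0 `|` \bigcup_(G in F) G =
      \bigcup_(G in [set G0] `|` [set G0 `|` G | G in F]) G.
    rewrite bigcup_setU bigcup_set1 bigcup_image; apply/seteqP; split => q.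
      by move=> [|[G FG Gq]]; [left|right; exists G => //; right].
    by move=> [|[G FG [|Gq]]]; [left|left|right; exists G].
  apply: square_bigcup; first by exists G0; left.
    by move=> G [->//|[H FH <-]]; exact: FP.
  move=> G H [->|[G' FG <-]] [->|[H' FH <-]].
  - by left.
  - by left; exact: subsetUl.
  - by right; exact: subsetUl.
  - by have [?|?] := Ftot _ _ FG FH; [left|right]; exact: setUS.
move=> M [MP Mmax]; set G := G0 `|` M in MP.
have Ginf : infinite_set (fld G).
  apply/infiniteP/card_le_relP; exists (fun i x => x = g i); split.
    move=> i _; exists (g i) => //.
    by have [z Gz] := fld0 i; exists z; left.
  by move=> i j x _ _ -> /g_inj.
have GT : [set: T] #<= fld G.
  have [le|nle] := pselect (~` fld G #<= fld G).
    by rewrite -(setUv (fld G)); apply: card_leU => //; exact: square_card.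
  have [H HP [GH nHG]] := square_extend MP Ginf nle.
  have [] := Mmax H; last first.
    by rewrite (_ : _ `|` _ = H) //; apply/setUidPr => q Gq; apply: GH; left.
  by split=> [q Mq|HM]; [apply: GH; right|apply: nHG => q /HM; right].
apply: card_le_trans (card_leT (fld G)).
by apply: card_le_trans (square_card MP); exact: card_leX.
Qed.
End square.

Lemma card_le_bigcup I T K (D : set I) (F : I -> set T) :
  infinite_set [set: K] -> D #<= [set: K] ->
  (forall i, D i -> F i #<= [set: K]) -> \bigcup_(i in D) F i #<= [set: K].
Proof.
move=> /infinite_square KK /card_le_relP[d [dt di]] FK.
apply: card_le_trans KK.
have /choice[r rP] : forall i, exists r : T -> K -> Prop, D i ->
    (forall x, F i x -> exists2 y, [set: K] y & r x y) /\
    (forall x x' y, F i x -> F i x' -> r x y -> r x' y -> x = x').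
  move=> i; have [Di|nDi] := pselect (D i); last by exists (fun _ _ => False).
  by have /card_le_relP[r rP] := FK _ Di; exists r.
apply/card_le_relP; exists (fun x p => exists i,
  [/\ D i, F i x, d i p.1 & r i x p.2]); split.
  move=> x [i Di Fix].
  have [k _ dk] := dt _ Di; have [l _ rl] := (rP _ Di).1 _ Fix.
  by exists (k, l) => //; exists i.
move=> x x' [k l] _ _ [i [Di Fi di' ri]] [j [Dj Fj dj rj]].
move: Fj rj; rewrite -(di _ _ _ Di Dj di' dj) => Fj rj.
exact: (rP _ Di).2 ri rj.
Qed.

(** * Binary series of functions *)

Section binary_sum.
Local Open Scope ring_scope.
Variable R : realType.
Implicit Types u : nat -> R.

Definition binary_partial u n : R := \sum_(0 <= i < n) u i * 2^-1 ^+ i.+1.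

Definition binary_sum u : R := limn (binary_partial u).

Definition unit_valued u := forall i, 0 <= u i <= 1.

Lemma binary_partialS u n :
  binary_partial u n.+1 = binary_partial u n + u n * 2^-1 ^+ n.+1.
Proof. by rewrite /binary_partial big_nat_recr. Qed.

Let half n : 2^-1 ^+ n.+1 = 2^-1 ^+ n / 2 :> R.
Proof. by rewrite exprSr. Qed.

Let half_gt0 n : 0 < 2^-1 ^+ n :> R.
Proof. by rewrite exprn_gt0 // invr_gt0. Qed.

Lemma binary_partial_nd u : unit_valued u ->
  {homo binary_partial u : n m / (n <= m)%N >-> n <= m}.
Proof.
move=> u01; apply: homo_leq => [x|y x z|n]; first exact: lexx.
  exact: le_trans.
rewrite binary_partialS lerDl mulr_ge0 //.
by have /andP[] := u01 n.
Qed.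

(** The tail beyond [n] is at most the sum of [2^-(i+1)] for [i >= n]. *)
Lemma binary_partial_le u m n : unit_valued u ->
  binary_partial u m <= binary_partial u n + 2^-1 ^+ n.
Proof.
move=> u01; have /(_ (m - n)%N) tail k : binary_partial u (n + k) <=
    binary_partial u n + 2^-1 ^+ n - 2^-1 ^+ (n + k).
  elim: k => [|k IH]; first by rewrite addn0 addrK.
  rewrite addnS binary_partialS half; have /andP[_ u1] := u01 (n + k)%N.
  have := half_gt0 (n + k); set a := _ ^+ (n + k) in IH * => a0.
  have : u (n + k)%N * (a / 2) <= a / 2 by rewrite ler_piMl // divr_ge0 // ltW.
  lra.
apply: le_trans (binary_partial_nd u01 (leq_maxr n m)) _.
by rewrite maxnE; apply: le_trans tail _; rewrite gerBl ltW.
Qed.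

Lemma binary_sum_bounds u n : unit_valued u ->
  binary_partial u n <= binary_sum u <= binary_partial u n + 2^-1 ^+ n.
Proof.
move=> u01; have nd := binary_partial_nd u01.
have cvg_u : cvgn (binary_partial u).
  apply: nondecreasing_is_cvgn => //.
  by exists (binary_partial u n + 2^-1 ^+ n) => _ [m _ <-]; exact: binary_partial_le.
rewrite (nondecreasing_cvgn_le nd cvg_u) /=.
by apply: limr_le => //; apply: nearW => m; exact: binary_partial_le.
Qed.

Lemma half_lt (e : R) : 0 < e -> exists n, 2^-1 ^+ n < e.
Proof.
move=> e0; have h1 : `|2^-1 : R| < 1 by rewrite ger0_norm ?invr_ge0 // invf_lt1 // ltr1n.
have /cvgrPdist_lt/(_ _ e0)[n _ /(_ n)] := cvg_geometric 1 h1.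
rewrite /= sub0r normrN mul1r ger0_norm ?ltW // => he.
by exists n; exact: he.
Qed.

(** The partial sums approximate uniformly, with error [2^-n]. *)
Lemma binary_sum_continuous (Y : topologicalType) (h : nat -> Y -> R) :
  (forall i, continuous (h i)) -> (forall y, unit_valued (h ^~ y)) ->
  continuous (fun y => binary_sum (h ^~ y)).
Proof.
move=> ch h01.
have cpart n : continuous (fun y => binary_partial (h ^~ y) n).
  elim: n => [|n IH] y.
    have -> : (fun y => binary_partial (h ^~ y) 0) = fun=> 0.
      by apply/funext => z; rewrite /binary_partial big_geq.
    exact: cst_continuous.
  have -> : (fun y => binary_partial (h ^~ y) n.+1) =
      (fun y => binary_partial (h ^~ y) n + h n y * 2^-1 ^+ n.+1).
    by apply/funext => z; rewrite binary_partialS.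
  by apply: cvgD; [exact: IH|apply: cvgM; [exact: ch|exact: cvg_cst]].
move=> y; apply/cvgrPdist_lt => e e0.
have [n ne] : exists n, 2^-1 ^+ n < e / 2 by apply: half_lt; rewrite divr_gt0.
have /cvgrPdist_lt/(_ (e / 2)) := cpart n y; rewrite divr_gt0 // => /(_ isT).
apply: filterS => z.
have := binary_sum_bounds n (h01 y); have := binary_sum_bounds n (h01 z).
rewrite !ltr_norml; lra.
Qed.

(** Greedy binary expansion: [r n] is the remainder after [n] digits, rescaled to
    the unit interval. *)
Lemma binary_sum_surj (t : R) : 0 <= t <= 1 ->
  exists b : nat -> bool, binary_sum (fun n => (b n)%:R) = t.
Proof.
move=> t01.
pose bit (r : R) := 2^-1 <= r.
pose r := fix r n : R := if n is m.+1 then 2 * r m - (bit (r m))%:R else t.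
pose b n := bit (r n).
have r01 n : 0 <= r n <= 1.
  by elim: n => [//|n IH] /=; rewrite /bit; case: (leP 2^-1 (r n)) IH => /=; lra.
have partE n : t = binary_partial (fun n => (b n)%:R) n + r n * 2^-1 ^+ n.
  elim: n => [|n IH]; first by rewrite /binary_partial big_geq //= add0r mulr1.
  by rewrite binary_partialS half /= {1}IH -/(b n); field.
have b01 : unit_valued (fun n => (b n)%:R) by move=> n; case: (b n); rewrite /= lexx ler01.
exists b; apply/eqP; rewrite -subr_eq0 -normr_eq0 eq_le normr_ge0 andbT.
apply/ler_addgt0Pl => e /half_lt[n ne]; rewrite addr0.
have := binary_sum_bounds n b01; have := partE n; have := r01 n.
have h0 := half_gt0 n => /andP[r0 r1].
have : 0 <= r n * 2^-1 ^+ n <= 2^-1 ^+ n by rewrite mulr_ge0 ?ler_piMl // ltW.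
rewrite ler_norml; lra.
Qed.

End binary_sum.

(** * The Cantor scheme *)

Lemma clamp_continuous (R : realType) (Y : topologicalType) (k : Y -> R) :
  continuous k -> continuous (fun y => Num.max 0 (Num.min 1 (k y)))%R.
Proof.
move=> ck y.
have cmin : {for y, continuous ((fun=> 1%R : R^o) \min (k : Y -> R^o))%R}.
  by apply: continuous_min; [exact: cst_continuous|exact: ck].
exact: (continuous_max (@cst_continuous _ R^o 0%R y) cmin).
Qed.

(** The sum over [j] of the products over [i] of functions separating [a i] from
    [b j] vanishes at the [a i] and is at least 1 at the [b j]; clamping it makes
    it constant near these points. *)
Lemma finite_separation (R : realType) (Y : topologicalType) (I : finType)
    (a b : I -> Y) :
  functionally_hausdorff R Y -> (forall i j, a i <> b j) ->
  exists h : Y -> R, [/\ continuous h, forall y, (0 <= h y <= 1)%R,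
    forall i, \forall y \near a i, h y = 0%R &
    forall i, \forall y \near b i, h y = 1%R].
Proof.
move=> FH ab.
have /choice[f0 fP0] : forall p : I * I, exists f : Y -> R,
    [/\ continuous f, range f `<=` `[0%R, 1%R], f (a p.1) = 0%R & f (b p.2) = 1%R].
  by move=> p; exact: FH.
pose f i j := f0 (i, j); have fP i j := fP0 (i, j).
pose k y := (\sum_j \prod_i f i j y)%R.
have f01 i j y : (0 <= f i j y <= 1)%R.
  by have [_ + _ _] := fP i j; move/(_ (f i j y)); rewrite /= in_itv /=; apply; exists y.
have ck : continuous k.
  apply: (@continuous_big R I +%R 0%R xpredT); first exact: add_continuous.
  move=> j _; apply: (@continuous_big R I *%R 1%R xpredT); first exact: mul_continuous.
  by move=> i _; have [] := fP i j.
have k0 i : k (a i) = 0%R.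
  apply: big1 => j _; apply/eqP; rewrite prodf_seq_eq0; apply/hasP; exists i.
    by rewrite mem_index_enum.
  by apply/eqP; have [] := fP i j.
have k1 j : (1 <= k (b j))%R.
  rewrite /k (bigD1 j) //= big1 => [|i _]; last by have [] := fP i j.
  rewrite lerDl sumr_ge0 // => j' _; apply: prodr_ge0 => i _.
  by have /andP[] := f01 i j' (b j).
have nlt (y : Y) (c : R) : (k y < c)%R -> \forall z \near y, (k z < c)%R.
  by move=> /lt_nbhsl/(ck y).
have ngt (y : Y) (c : R) : (c < k y)%R -> \forall z \near y, (c < k z)%R.
  by move=> /lt_nbhsr/(ck y).
(* The slope 3 sends [k < 1/3] below 0 and [k > 2/3] above 1. *)
exists (fun y => Num.max 0%R (Num.min 1%R (3 * k y - 1)))%R; split.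
- apply: clamp_continuous => y.
  by apply: cvgB; [apply: cvgM; [exact: cvg_cst|exact: ck]|exact: cvg_cst].
- by move=> y; rewrite le_max lexx /= ge_max ler01 ge_min lexx.
- move=> i; have : (k (a i) < 3^-1)%R by rewrite k0 invr_gt0.
  move=> /nlt; apply: filterS => y ky; apply/max_idPl; rewrite ge_min.
  by apply/orP; right; lra.
- move=> j; have : (2 / 3 < k (b j))%R by apply: lt_le_trans (k1 j); lra.
  move=> /ngt; apply: filterS => y ky; rewrite min_l; last lra.
  by apply/max_idPr; exact: ler01.
Qed.

Lemma embedding_continuous (P C : topologicalType) (e : P -> C) :
  embedding e -> continuous e.
Proof. by move=> [_ eo]; apply/continuousP => O oO; rewrite eo; exists O. Qed.

Lemma embedding_nbhs (P C : topologicalType) (e : P -> C) (x : P) (N : set P) :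
  embedding e -> nbhs x N ->
  exists O, [/\ open O, O (e x) & e @^-1` O `<=` N].
Proof.
move=> [_ eo]; rewrite nbhsE => -[V [+ Vx] VN]; rewrite eo => -[Q oQ QV].
by rewrite -QV in Vx; exists Q; rewrite QV.
Qed.

Lemma embedding_compact_preimage (P C : topologicalType) (e : P -> C) (K : set C) :
  embedding e -> compact K -> K `<=` range e -> compact (e @^-1` K).
Proof.
move=> emb cK Ke F FF FK.
have [] := cK (e @ F) _ FK; move=> c [Kc cl].
have [x _ xc] := Ke _ Kc; exists x; split; first by rewrite /= xc.
move=> A N FA /(embedding_nbhs emb)[Q [oO Ox ON]].
have [||_ [[z Az <-] Oz]] := cl (e @` A) Q.
- by rewrite nbhs_simpl /=; apply: (@filterS _ F _ A) FA => z Az; exists z.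
- by rewrite -xc; exact: open_nbhs_nbhs.
- by exists z; split => //; exact: ON.
Qed.

Lemma compact_nested (C : topologicalType) (G : nat -> set C) :
  compact [set: C] -> (forall n, closed (G n)) -> (forall n, G n !=set0) ->
  (forall n, G n.+1 `<=` G n) -> \bigcap_n G n !=set0.
Proof.
move=> cC clG G0 Gdec; have /choice[c cP] := G0.
have Gle m n : (n <= m)%N -> G m `<=` G n.
  move=> /subnK <-; elim: (m - n)%N => [//|k IH].
  exact: subset_trans (Gdec _) IH.
have [] := cC (c @ \oo) _ filterT => x [_ cl].
exists x => n _; rewrite ((closure_id _).1 (clG n)) => N Nx.
apply: cl Nx; exists n => // m /= nm; exact: (Gle m n).
Qed.

Section scheme.
Context (R : realType) (P C Y : topologicalType).
Variables (e : P -> C) (W : nat -> set C) (g : P -> Y) (T : set P).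
Hypotheses (cC : compact [set: C]) (hC : hausdorff_space C).
Hypotheses (emb : embedding e) (oW : forall n, open (W n)).
Hypotheses (eW : range e = \bigcap_n W n) (cg : continuous g).
Hypotheses (FH : functionally_hausdorff R Y) (T0 : T !=set0).
Hypothesis (splitT : forall U : set P, open U -> T `&` U !=set0 ->
  exists x y, [/\ (T `&` U) x, (T `&` U) y & g x <> g y]).

(** Only the words of length [n] matter at level [n]. The second clause makes the
    points of [Y] chosen at the next level pairwise distinct, as
    [finite_separation] requires. *)
Let level n (U : seq bool -> set C) :=
  (forall s, size s = n -> open (U s) /\ exists2 x, T x & U s (e x)) /\
  (forall s t x y, size s = n -> size t = n -> s <> t ->
     U s (e x) -> U t (e y) -> g x <> g y).

(** A word lists the bits of a branch with the most recent one in front, so that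
    the parent of [b :: s] is [s]. *)
Let refines n (U U' : seq bool -> set C) (h : Y -> R) :=
  [/\ continuous h, forall y, (0 <= h y <= 1)%R &
  forall s b, size s = n ->
    closure (U' (b :: s)) `<=` U s `&` W n /\
    forall x, U' (b :: s) (e x) -> h (g x) = (b%:R)%R].

(** In each [U s] pick two points of [T] with distinct images. One function
    separates all the first images from all the second ones, and the new open
    sets are small neighbourhoods of the picked points. *)
Lemma level_refine n U : level n U ->
  exists U' h, level n.+1 U' /\ refines n U U' h.
Proof.
move=> [Uo Usep]; have ce := embedding_continuous emb.
have [p0 _] := T0.
have /choice[a aP] : forall s, exists a : P * P, size s = n ->
    [/\ (T `&` e @^-1` U s) a.1, (T `&` e @^-1` U s) a.2 & g a.1 <> g a.2].
  move=> s; have [sn|/eqP nsn] := eqVneq (size s) n; last by exists (p0, p0).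
  have [oUs [x Tx Ux]] := Uo _ sn.
  have [||u [v [? ? ?]]] := splitT (U := e @^-1` U s).
  - by move: (U s) oUs; apply/continuousP.
  - by exists x.
  - by exists (u, v).
have [|h [ch h01 h0 h1]] := @finite_separation R Y (n.-tuple bool)
  (fun s => g (a s).1) (fun s => g (a s).2) FH.
  move=> s t; have [[_ Us] _ nst] := aP s (size_tuple s).
  have [_ [_ Ut] _] := aP t (size_tuple t).
  have [<- //|st] := eqVneq s t; apply: Usep Us Ut; rewrite ?size_tuple //.
  by move=> /val_inj E; rewrite E eqxx in st.
have nb b s (sn : size s = n) : nbhs (if b then (a s).2 else (a s).1)
    [set x | h (g x) = (b%:R)%R].
  pose t : n.-tuple bool := tcast sn (in_tuple s).
  have ts : tval t = s by rewrite /t val_tcast.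
  by case: b; [move: (h1 t)|move: (h0 t)]; rewrite /= ts => /cg.
(* The choice function is total on words; it is constrained on length [n.+1] only. *)
have /choice[U' U'P] : forall t, exists V : set C,
    if t is b :: s then size s = n ->
      [/\ open V, V (e (if b then (a s).2 else (a s).1)),
        closure V `<=` U s `&` W n & forall x, V (e x) -> h (g x) = (b%:R)%R]
    else True.
  case=> [|b s]; first by exists set0.
  have [sn|/eqP nsn] := eqVneq (size s) n; last by exists set0.
  have [Q [oO Op Oh]] := embedding_nbhs emb (nb b s sn).
  set p := (if b then _ else _) in Op *.
  have [Tp Up] : (T `&` e @^-1` U s) p.
    by rewrite /p; have [a1 a2 _] := aP s sn; case: (b).
  have Wp : W n (e p).
    by have : range e (e p) by []; rewrite eW => /(_ n I).
  have [V Vp clV] : filter_from (nbhs (e p)) closure (U s `&` W n `&` Q).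
    apply: (@compact_regular C (e p) setT hC cC filterT).
    by apply: filterI; [apply: filterI|]; apply: open_nbhs_nbhs; split => //;
      exact: (Uo _ sn).1.
  exists V°; split.
  - exact: open_interior.
  - exact: Vp.
  - apply: subset_trans (closure_subset (@interior_subset _ V)) _.
    by move=> z /clV[].
  - by move=> x /interior_subset/subset_closure/clV[_ /Oh].
exists U', h; split.
  split.
    case=> [//|b s] [sn]; have [oU' U'e _ _] := U'P (b :: s) sn; split => //.
    exists (if b then (a s).2 else (a s).1) => //.
    by have [[Ta _] [Ta' _] _] := aP s sn; case: (b).
  case=> [//|b s] [//|b' t] x y [sn] [tn] bs Ux Uy gxy.
  have [_ _ Us hx] := U'P (b :: s) sn; have [_ _ Ut hy] := U'P (b' :: t) tn.
  have [st|st] := eqVneq s t; last first.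
    apply: Usep sn tn _ _ _ gxy; first exact/eqP.
      by have [] := Us _ (subset_closure Ux).
    by have [] := Ut _ (subset_closure Uy).
  apply: bs; rewrite st; congr cons.
  have := hx _ Ux; rewrite gxy (hy _ Uy) => /eqP.
  by case: (b); case: (b') => //=; rewrite ?(oner_eq0, eq_sym 0%R).
by split => // s b sn; have [] := U'P (b :: s) sn.
Qed.

Lemma levels : exists (U : nat -> seq bool -> set C) (h : nat -> Y -> R),
  forall n, level n (U n) /\ refines n (U n) (U n.+1) (h n).
Proof.
pose X := {p : nat * (seq bool -> set C) * (Y -> R) | level p.1.1 p.1.2}.
pose S (p q : X) := (sval q).1.1 = (sval p).1.1.+1 /\
  refines (sval p).1.1 (sval p).1.2 (sval q).1.2 (sval q).2.
have step p : {q | S p q}.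
  apply: cid; case: p => -[[n U] h] /= L.
  have [U' [h' [L' ref]]] := level_refine L.
  by exists (exist _ (n.+1, U', h') L').
have L0 : level 0 (fun=> setT).
  split; last by case=> // -[].
  by move=> s _; split; [exact: openT|have [x Tx] := T0; exists x].
have [F [F0 FS]] := dependent_choice step (exist _ (0%N, fun=> setT, fun=> 0%R) L0).
have Fn n : (sval (F n)).1.1 = n.
  by elim: n => [|n IH]; [rewrite F0|rewrite (FS n).1 IH].
exists (fun n => (sval (F n)).1.2), (fun n => (sval (F n.+1)).2) => n.
by split; [have := svalP (F n)|have [_] := FS n]; rewrite Fn.
Qed.

(** A point common to the sets along the branch [b] lies in the [n]-th open set
    [W n] for all [n], so it comes from [P], and [h n] takes the value [b n] at
    its image. *)
Lemma compact_onto_interval : exists K : set P, compact K /\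
  exists phi : Y -> R, [/\ continuous phi, range phi `<=` `[0%R, 1%R] &
    `[0%R, 1%R] `<=` (phi \o g) @` K].
Proof.
have [U [h LU]] := levels.
pose K := \bigcap_n \bigcup_(s in [set s : seq bool | size s = n]) closure (U n s).
have clK : closed K.
  apply: closed_bigI => n _; apply: closed_bigcup => [|s _]; last exact: closed_closure.
  apply: (@sub_finite_set _ _ [set tval t | t in [set: n.-tuple bool]]).
    by move=> s /= sn; exists (tcast sn (in_tuple s)) => //; rewrite val_tcast.
  by apply: finite_image; exact: finite_finset.
have Ke : K `<=` range e.
  move=> c Kc; rewrite eW => n _; have [[|b s] //= [sn] cl] := Kc n.+1 I.
  by have [_ [_ _ /(_ s b sn)[/(_ _ cl)[]]]] := LU n.
exists (e @^-1` K); split.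
  apply: embedding_compact_preimage => //.
  by apply: subclosed_compact cC _.
have h01 y : unit_valued (h ^~ y) by move=> n; have [_ []] := LU n.
exists (fun y => binary_sum (h ^~ y)); split.
- by apply: binary_sum_continuous => // n; have [_ []] := LU n.
- move=> _ [y _ <-]; have := binary_sum_bounds 0 (h01 y).
  by rewrite /binary_partial big_geq // add0r expr0 /= in_itv.
move=> t; rewrite /= in_itv /= => /binary_sum_surj[b <-].
pose pre := fix pre n := if n is m.+1 then b m :: pre m else [::].
have size_pre n : size (pre n) = n by elim: n => //= n ->.
have [||n|c cP] := @compact_nested C (fun n => closure (U n (pre n))) cC.
- by move=> n; exact: closed_closure.
- move=> n; have [[/(_ _ (size_pre n))[_ [x _ Ux]] _] _] := LU n.
  by exists (e x); exact: subset_closure.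
- have [_ [_ _ /(_ (pre n) (b n) (size_pre n))[sub _]]] := LU n.
  by move=> c /= /sub[Uc _]; exact: subset_closure.
have Kc : K c by move=> n _; exists (pre n); [exact: size_pre|exact: cP].
have [x _ xc] := Ke c Kc; exists x; first by rewrite /= xc.
rewrite /=; congr binary_sum; apply/funext => n.
have [_ [_ _ /(_ (pre n) (b n) (size_pre n))[_ ->]]] //= := LU n.
have [_ [_ _ /(_ (pre n.+1) (b n.+1) (size_pre n.+1))[+ _]]] := LU n.+1.
by move=> /(_ c (cP n.+2 I))[]; rewrite xc.
Qed.

End scheme.

(** * Compact scattered spaces *)

(** [0,1] has no isolated point. *)
Lemma closed_interval_punctured (R : realType) (B : set R) (t : R) :
  closed B -> `[0%R, 1%R] `\ t `<=` B -> `[0%R, 1%R] `<=` B.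
Proof.
move=> clB sub s; have [->|st] := eqVneq s t; last first.
  by move=> s01; apply: sub; split => //; exact/eqP.
rewrite /= in_itv /= => t01; apply: clB => N /nbhs_ballP[e /= e0 eN].
pose d := (Num.min (e / 2) 2^-1)%R.
have d0 : (0 < d)%R by rewrite lt_min divr_gt0 //= invr_gt0.
have de : (d <= e / 2)%R by rewrite ge_min lexx.
have dh : (d <= 2^-1)%R by rewrite ge_min lexx orbT.
have [th|th] := leP t 2^-1%R.
  exists (t + d)%R; split.
    by apply: sub; rewrite /= in_itv /=; split; [lra|apply/eqP; lra].
  by apply: eN; rewrite /ball /= opprD addNKr normrN gtr0_norm; lra.
exists (t - d)%R; split.
  by apply: sub; rewrite /= in_itv /=; split; [lra|apply/eqP; lra].
by apply: eN; rewrite /ball /= opprB addrC subrK gtr0_norm; lra.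
Qed.

(** Take an open [M] maximal among those whose complement is still mapped onto
    [0,1]; compactness makes unions of chains admissible. An isolated point [z]
    of the complement can be removed: the image loses at most [psi z], and it
    stays closed. *)
Lemma compact_scattered_not_onto (R : realType) (S : topologicalType)
    (psi : S -> R) :
  compact [set: S] -> scattered S -> continuous psi ->
  ~ `[0%R, 1%R] `<=` range psi.
Proof.
move=> cS scS cpsi onto.
pose onto_off (O : set S) := open O /\ `[0%R, 1%R] `<=` psi @` (~` O).
have [] := @Zorn_bigcup S onto_off.
  move=> F FP Ftot; split.
    by apply: bigcup_open => O /FP[].
  move=> t t01.
  (* The empty set is added to have a filter base even for the empty chain. *)
  pose D := F `|` [set set0].
  have DP O : D O -> onto_off O.
    move=> [/FP //|->]; split; first exact: open0.
    by rewrite setC0; exact: onto.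
  have Dtot : total_on D subset.
    by move=> O O' [FO|->] [FO'|->]; [exact: Ftot|right|left|left].
  pose E O := ~` O `&` psi @^-1` [set t].
  have clE O : D O -> closed (E O).
    move=> /DP[oO _]; apply: closedI; first exact: open_closedC.
    by apply: preimage_closed; [move=> x _; exact: cpsi|exact: closed_eq].
  have PF : ProperFilter (filter_from D E).
    apply: filter_from_proper.
      apply: filter_from_filter; first by exists set0; right.
      move=> A B DA DB; have [sub|sub] := Dtot _ _ DA DB.
        by exists B => // x [nO' xt]; split; split => // /sub.
      by exists A => // x [nO xt]; split; split => // /sub.
    by move=> O /DP[_ /(_ t t01)[x nO xt]]; exists x.
  have [|x [_ clx]] := cS _ PF; first by exists set0 => //; right.
  have Ex O : D O -> E O x.
    move=> DO; apply: clE => // N Nx; apply: clx Nx; by exists O.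
  exists x; last by have [|] := Ex set0; first right.
  by move=> [A FA Ax]; have [|/(_ Ax)] := Ex A; first left.
move=> M [[oM Monto] Mmax].
have [x nMx] : (~` M) !=set0.
  have [|x nM _] := Monto 0%R; last by exists x.
  by rewrite /= in_itv /= lexx ler01.
have [z [/set_mem nMz [V Vz VM]]] : isolated (~` M) !=set0.
  by apply: scS; exists x.
apply: (Mmax (M `|` V°)).
  split; first exact: subsetUl.
  by move=> /(_ z (or_intror Vz)).
have oMV : open (M `|` V°) by apply: openU => //; exact: open_interior.
split => //; apply: (@closed_interval_punctured R _ (psi z)).
  apply: compact_closed; first exact: Rhausdorff.
  apply: continuous_compact; first exact: continuous_subspaceT.
  by apply: (subclosed_compact _ cS) => //; exact: open_closedC.
move=> t [/Monto[y nMy <-] yz]; exists y => //= -[//|/interior_subset Vy].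
apply: yz => /=; congr psi.
by have : (V `&` ~` M) y by []; rewrite VM.
Qed.

(** * Functionally Hausdorff and metric spaces *)

Section functionally_hausdorff_lemmas.
Variable R : realType.

Lemma functionally_hausdorff_comp (S X : topologicalType) (j : S -> X) :
  injective j -> continuous j ->
  functionally_hausdorff R X -> functionally_hausdorff R S.
Proof.
move=> ij cj FH x y xy; have [|f [cf f01 fx fy]] := FH (j x) (j y).
  by move=> /ij.
exists (f \o j); split => //.
- by move=> z; apply: continuous_comp; [exact: cj|exact: cf].
- by move=> _ [z _ <-]; apply: f01; exists (j z).
Qed.

Lemma functionally_hausdorff_hausdorff (X : topologicalType) :
  functionally_hausdorff R X -> hausdorff_space X.
Proof.
move=> FH x y; apply: contraPP => /FH[f [cf _ fx fy]] clxy.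
have [||z [/= zl zr]] := clxy (f @^-1` [set u | (u < 2^-1)%R])
  (f @^-1` [set u | (2^-1 < u)%R]).
- apply: cf; apply: open_nbhs_nbhs; split; first exact: open_lt.
  by rewrite /= fx invr_gt0.
- apply: cf; apply: open_nbhs_nbhs; split; first exact: open_gt.
  by rewrite /= fy invf_lt1 // ltr1n.
- by have := lt_trans zl zr; rewrite ltxx.
Qed.

Lemma metric_functionally_hausdorff (Y : metricType R) :
  functionally_hausdorff R Y.
Proof.
move=> x y xy; have d0 : (0 < mdist x y)%R by rewrite mdist_gt0; exact/eqP.
exists (fun z => Num.max 0 (Num.min 1 (mdist x z / mdist x y)))%R; split.
- apply: clamp_continuous => z; apply: cvgM; last exact: cvg_cst.
  apply/cvgrPdist_lt => e e0; have := nbhsx_ballx z _ e0.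
  apply: filterS => w; rewrite ballEmdist /= => zw.
  have := metric_triangle x z w; have := metric_triangle x w z.
  by rewrite (metric_sym w z) ltr_norml; lra.
- move=> _ [z _ <-]; rewrite /= in_itv /= le_max lexx /=.
  by rewrite ge_max ler01 ge_min lexx.
- by rewrite mdistxx mul0r min_r ?ler01 // maxxx.
- by rewrite divff ?gt_eqF // minxx max_r ?ler01.
Qed.

End functionally_hausdorff_lemmas.

Lemma set_val_embedding (X : topologicalType) (K : set X) :
  embedding (set_val : set_type K -> X).
Proof. by split; first exact: val_inj. Qed.

Lemma compact_set_type (X : topologicalType) (K : set X) :
  compact K -> compact [set: set_type K].
Proof.
move=> cK; have -> : [set: set_type K] = set_val @^-1` K.
  by apply/seteqP; split => // x _; exact: (set_mem (valP x)).
apply: (embedding_compact_preimage (@set_val_embedding X K) cK).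
by move=> x Kx; exists (SigSub (mem_set Kx)).
Qed.

Lemma pseudocharacter_metric (R : realType) (Y : metricType R) :
  pseudocharacter_bound Y nat.
Proof.
move=> y.
have openV n : open_nbhs y [set z | mdist y z < n.+1%:R^-1]%R.
  split.
    rewrite openE => z /= yz; have e0 : (0 < n.+1%:R^-1 - mdist y z)%R by rewrite subr_gt0.
    have := nbhsx_ballx z _ e0; apply: filterS => w; rewrite ballEmdist /=.
    by rewrite ltrBrDl; apply: le_lt_trans; exact: metric_triangle.
  by rewrite /= mdistxx invr_gt0 ltr0n.
exists [set [set z | mdist y z < n.+1%:R^-1]%R | n in [set: nat]]; split.
- by move=> _ [n _ <-].
- exact: card_image_le.
- apply/seteqP; split => z zV U; last by move=> [n _ <-]; apply: zV; exact: openV.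
  suff -> : z = y by move=> [].
  apply: mdist_positivity; apply/eqP; rewrite eq_le mdist_ge0 andbT metric_sym.
  apply/ler_addgt0Pl => e e0; rewrite addr0.
  have [n _ /(_ n (leqnn n)) /= ne] := near_infty_natSinv_lt (PosNum e0).
  by apply: le_trans (ltW ne); apply: ltW; apply: (zV [set z | mdist y z < n.+1%:R^-1]%R); exists n.
Qed.

(** * Maps with large image *)

Lemma embedding_regular (P C : topologicalType) (e : P -> C) :
  compact [set: C] -> hausdorff_space C -> embedding e -> regular_space P.
Proof.
move=> cC hC emb x N Nx.
have [Q [oQ Qx QN]] := embedding_nbhs emb Nx.
have [V Vx VQ] : filter_from (nbhs (e x)) closure Q.
  by apply: (@compact_regular C (e x) setT hC cC filterT); exact: open_nbhs_nbhs.
exists (e @^-1` V); first exact: (embedding_continuous emb).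
apply: subset_trans QN => y ycl; apply: VQ => O Oy.
have [z [Vz Oz]] := ycl _ (embedding_continuous emb Oy).
by exists (e z).
Qed.

Section kernel.
Context (P Y : topologicalType) (g : P -> Y) (K : Type).

Let small (A : set P) := g @` A #<= [set: K].

Definition condensation : set P :=
  [set x | forall U, open U -> U x -> ~ small U].

(** Cover [P] by the complement of [F] and by the open sets with small image; a
    subcover of size at most [K] exhibits [g @` F] as a union of at most [K] sets
    of size at most [K]. *)
Lemma closed_off_condensation (F : set P) (L : Type) :
  infinite_set [set: K] -> lindelof_bound P L -> [set: L] #<= [set: K] ->
  closed F -> F `&` condensation `<=` set0 -> small F.
Proof.
move=> Kinf [_ lindelof] LK clF FT.
pose U_cover := [set U : set P | open U /\ (small U \/ U = ~` F)].
have [| |D [Dc DT DL]] := lindelof U_cover.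
- by move=> U [].
- apply/seteqP; split => // x _; have [Fx|nFx] := pselect (F x); last first.
    by exists (~` F) => //; split; [exact: closed_openC|right].
  have /existsNP[U /not_implyP[oU /not_implyP[Ux /contrapT sU]]] :
      ~ condensation x by move=> Tx; exact: (FT x).
  by exists U => //; split => //; left.
have : \bigcup_(U in D) g @` (U `&` F) #<= [set: K].
  apply: card_le_bigcup => //; first exact: card_le_trans DL LK.
  move=> U /Dc[_ [sU|->]]; last by rewrite setICl image_set0 card_ge0.
  by apply: card_le_trans sU; apply: subset_card_le; apply: image_subset => x [].
apply: card_le_trans; apply: subset_card_le => _ [x Fx <-].
have : [set: P] x by []; rewrite -DT => -[U DU Ux].
by exists U => //; exists x.
Qed.

(** Otherwise [g] has a single value [y] on the condensation points in [U]. Let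
    [N] be a neighbourhood of [x] with [closure N] inside [U]. For [W] in a family
    of open sets with intersection [[set y]], the part of [closure N] that is
    mapped outside [W] is closed and has no condensation point, so its image is
    small. These images and [[set y]] cover [g @` N], against the choice of
    [x]. *)
Lemma condensation_split (L : Type) (U : set P) :
  infinite_set [set: K] -> lindelof_bound P L -> [set: L] #<= [set: K] ->
  regular_space P -> continuous g ->
  (forall y : Y, exists V : set (set Y),
    [/\ V `<=` open, V #<= [set: K] & \bigcap_(W in V) W = [set y]]) ->
  open U -> condensation `&` U !=set0 ->
  exists x y, [/\ (condensation `&` U) x, (condensation `&` U) y & g x <> g y].
Proof.
move=> Kinf lindelof LK reg cg psi oU [x [Tx Ux]]; apply: contrapT => nsplit.
have const z : condensation z -> U z -> g z = g x.
  by move=> Tz Uz; apply: contrapT => gzx; apply: nsplit; exists z, x.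
have [N Nx NU] := reg x U (open_nbhs_nbhs (conj oU Ux)).
have [V [Vo VK VE]] := psi (g x).
apply: (Tx N°) => //; first exact: open_interior.
have : [set g x] `|` \bigcup_(W in V) g @` (closure N `&` g @^-1` (~` W)) #<= [set: K].
  apply: card_leU => //.
  - by rewrite setXTT; apply: card_le_trans (infinite_square Kinf); rewrite setXTT.
  - apply: card_le_trans ((infiniteP _).1 Kinf).
    by rewrite (card_le_eql card_set1); exact: card_leT.
  apply: card_le_bigcup => // W VW.
  apply: closed_off_condensation Kinf lindelof LK _ _.
    apply: closedI; first exact: closed_closure.
    apply: preimage_closed; first by move=> z _; exact: cg.
    by apply: open_closedC; exact: Vo.
  move=> z [[clz nWz] Tz]; apply: nWz; rewrite (const z Tz (NU _ clz)).
  by have : [set g x] (g x) by []; rewrite -VE => /(_ W VW).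
apply: card_le_trans; apply: subset_card_le => _ [z /interior_subset Nz <-].
have [->|gzx] := pselect (g z = g x); first by left.
right; have : ~ [set g x] (g z) by [].
rewrite -VE => /existsNP[W /not_implyP[VW nWz]].
by exists W => //; exists z => //; split => //; exact: subset_closure.
Qed.

End kernel.

Lemma card_max_ubl (K L : Type) : [set: K] #<= [set: card_max K L].
Proof. by rewrite /card_max; case: ifP => // _; exact: card_lexx. Qed.

Lemma card_max_ubr (K L : Type) : [set: L] #<= [set: card_max K L].
Proof.
rewrite /card_max; case: ifPn => [_|]; first exact: card_lexx.
by have /orP[->|] := card_le_total [set: K] [set: L].
Qed.

Lemma analyticity_infinite (X : topologicalType) :
  infinite_set [set: analyticity X].
Proof.
have [[P [f [_ PX _ _]]] _] := min_cardP (analytic_ex X).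
have [[/infiniteP linf _] _] := min_cardP (lindelof_bound_ex P).
by apply/infiniteP; exact: card_le_trans PX.
Qed.

(** The condensation points of the composite of [f] with a Cech-complete
    presentation of [X] are the set on which the scheme is run. *)
Lemma large_image_interval (R : realType) (X Y : topologicalType) (f : X -> Y)
    (K : Type) :
  [set: analyticity X] #<= [set: K] -> pseudocharacter_bound Y K ->
  functionally_hausdorff R Y -> continuous f -> ~ (range f #<= [set: K]) ->
  exists Z : set X, compact Z /\ exists phi : Y -> R,
    continuous phi /\ `[0%R, 1%R] `<=` (phi \o f) @` Z.
Proof.
move=> aK psi FH cf large.
have [[P [p [[_ [C [e [[cC hC emb _] [W oW eW]]]]] PX cp pX]]] _] :=
  min_cardP (analytic_ex X).
have [lindelof _] := min_cardP (lindelof_bound_ex P).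
have LK := card_le_trans PX aK.
have Kinf : infinite_set [set: K].
  apply/infiniteP; apply: card_le_trans aK.
  exact/infiniteP/analyticity_infinite.
have cg : continuous (f \o p).
  by move=> x; apply: continuous_comp; [exact: cp|exact: cf].
have T0 : condensation (f \o p) K !=set0.
  apply/set0P/eqP => T0; apply: large.
  have <- : (f \o p) @` setT = range f by rewrite -image_comp pX.
  apply: (closed_off_condensation Kinf lindelof LK closedT).
  by rewrite T0 setI0.
have [|Z [cZ [phi [cphi _ onto]]]] :=
  @compact_onto_interval R P C Y e W (f \o p) _ cC hC emb oW eW cg FH T0.
  move=> U; apply: condensation_split Kinf lindelof LK _ cg _.
    exact: embedding_regular cC hC emb.
  move=> y; have [V [Vo VK VE]] := psi y; exists V; split => //.
    by move=> U' /Vo[].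
  rewrite VE; apply/seteqP; split => z; last by move=> -> U' [].
  have := hausdorff_accessible (functionally_hausdorff_hausdorff FH).
  move=> /accessible_closed_set1 clz yz; apply: contrapT => zy.
  have : (~` [set z]) z.
    by apply: yz; split; [exact/closed_openC/clz|move=> /= /esym].
  exact.
exists (p @` Z); split.
  by apply: continuous_compact => //; exact: continuous_subspaceT.
exists phi; split => // t /onto[x Zx <-]; exists (p x) => //; by exists x.
Qed.

(** [contract] maps the line injectively into [-1,1]. *)
Lemma card_le_unit_interval (R : realType) :
  [set: R] #<= (`[0%R, 1%R] : set R).
Proof.
apply/card_le_relP; exists (fun x y => y = (contract x%:E + 1) / 2)%R; split.
  move=> x _; eexists; last reflexivity.
  by have := contract_le1 x%:E; rewrite ler_norml /= in_itv /=; lra.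
move=> x x' y _ _ -> E; apply: EFin_inj; apply: contract_inj; lra.
Qed.

Theorem theorem3 (R : realType) (X : topologicalType)
    (hX : functionally_hausdorff R X)
    (halpha : [set: analyticity X] #< [set: R]) :
  [<-> k_scattered X;
       forall (Y : topologicalType) (f : X -> Y),
         functionally_hausdorff R Y -> continuous f ->
         range f #<= [set: card_max (analyticity X) (pseudocharacter Y)];
       forall (Y : metricType R) (f : X -> Y),
         continuous f -> range f #< [set: R];
       ~ exists f : X -> R, continuous f /\ range f = `[0%R, 1%R] ].
Proof.
tfae.
- move=> kX Y f FH cf; apply: contrapT => large.
  have [|Z [cZ [phi [cphi onto]]]] :=
    large_image_interval (card_max_ubl _ _) _ FH cf large.
    move=> y; have [psi _] := min_cardP (pseudocharacter_bound_ex Y).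
    have [V [Vo VK VE]] := psi y; exists V; split => //.
    exact: card_le_trans (card_max_ubr _ _).
  apply: (@compact_scattered_not_onto R (set_type Z) (phi \o f \o set_val)).
  + exact: compact_set_type.
  + exact: kX.
  + move=> z; apply: continuous_comp; first exact: initial_continuous.
    by apply: continuous_comp; [exact: cf|exact: cphi].
  + by move=> t /onto[x Zx <-]; exists (SigSub (mem_set Zx)).
- move=> h2 Y f cf.
  have /andP[aR nRa] := halpha.
  have fa : range f #<= [set: analyticity X].
    apply: card_le_trans (h2 Y f (@metric_functionally_hausdorff R Y) cf) _.
    rewrite /card_max; case: ifPn => _; last exact: card_lexx.
    have [_ /(_ nat (@pseudocharacter_metric R Y)) le] :=
      min_cardP (pseudocharacter_bound_ex Y).
    by apply: card_le_trans le _; exact/infiniteP/analyticity_infinite.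
  apply/andP; split; first exact: card_le_trans aR.
  by apply: contra nRa => Rf; exact: card_le_trans fa.
- move=> h3 [f [cf fE]].
  have /andP[_ /negP] := h3 R^o f cf; apply; rewrite fE.
  exact: card_le_unit_interval.
- move=> h4 Z cZ A [a Aa].
  apply: contrapT => niso; apply: h4.
  have set_val_inj : injective (set_val : set_type Z -> X) by exact: val_inj.
  have val_cont : continuous (set_val : set_type Z -> X) by exact: initial_continuous.
  have hZ : hausdorff_space (set_type Z).
    exact: functionally_hausdorff_hausdorff (functionally_hausdorff_comp set_val_inj val_cont hX).
  have id_emb : embedding (@idfun (set_type Z)).
    split => //; apply/seteqP; split => [U oU|_ [U oU <-] //].
    by exists U.
  (* A compact Hausdorff space is its own compactification. *)
  have [||U oU [x [Ax Ux]]|K [_ [phi [cphi phi01 onto]]]] :=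
    @compact_onto_interval R (set_type Z) (set_type Z) X idfun (fun=> setT)
      set_val A (compact_set_type cZ) hZ id_emb (fun=> openT) _ val_cont hX.
  + rewrite bigcap_const; last by exists 0%N.
    by apply/seteqP; split => // x _; exists x.
  + by exists a.
  + apply: contrapT => nsplit; apply: niso; exists x; split; first exact/mem_set.
    exists U; first exact: open_nbhs_nbhs.
    apply/seteqP; split => [y [Uy Ay]|_ ->] //=.
    by apply: contrapT => yx; apply: nsplit; exists y, x; split => // /set_val_inj.
  exists phi; split => //; apply/seteqP; split => // t /onto[x _ <-].
  by exists (set_val x).
Qed.
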